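(* Let $(T_\xi)$ be a family of operators $T_\xi\colon\mathcal H\to\mathcal H$, with $\xi\sim\mathcal D$, such that $T_\xi$ is nonexpansive for $\mathcal D$-almost all $\xi$ and, for each $x\in\mathcal H$, the map $\xi\mapsto T_\xi x$ is measurable and Bochner integrable. Define $Tx=\mathbb E_{\xi\sim\mathcal D}[T_\xi x]$ and assume $\mathrm{Fix}(T)\neq\emptyset$. Assume that for some $p_0\in\mathrm{Fix}(T)$, $\mathbb E[\|(T_\xi-T)p_0\|^2]\le\sigma_*^2<+\infty$. Let $(\lambda_k)_{k\ge0}\subset(0,1)$, $x_0\in\mathcal H$, and let $(x_k)$ be the random iterates of the stochastic Krasnoselskii-Mann algorithm $x_{k+1}=(1-\lambda_k)x_k+\lambda_kT_{\xi_k}(x_k)$, where $\xi_0,\xi_1,\dots$ are drawn independently from $\mathcal D$. Then, for every $K\ge1$, $$\mathbb E\left[\|Tx_K-x_K\|^2\right]\le\left(16Q_K+\frac{2}{\sum_{k=0}^{K-1}\lambda_k(1-\lambda_k)}\right)\frac{\mathrm{dist}(x_0,\mathrm{Fix}(T))^2+2\sum_{k=0}^{K-1}\lambda_k^2\sigma_*^2}{\Lambda_K}+16Q_K\sigma_*^2,$$ where $$Q_K=\frac{\sum_{k=0}^{K-1}\Lambda_{k+1}\lambda_k(1-\lambda_k)\sum_{i=k}^{K-1}\lambda_i^2}{\sum_{k=0}^{K-1}\Lambda_{k+1}\lambda_k(1-\lambda_k)}.$$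
   Context: $\mathcal H$ is a real separable Hilbert space with norm $\|\cdot\|$, and $\mathcal D$ is a probability distribution. An operator $S$ is nonexpansive if $\|Sx-Sy\|\le\|x-y\|$ for all $x,y\in\mathcal H$. $\mathrm{Fix}(T)=\{x\colon Tx=x\}$ and $\mathrm{dist}(x,F)=\inf_{p\in F}\|x-p\|$. The starting point $x_0$ is a fixed (deterministic) point. Define $\Lambda_k=\prod_{i=0}^{k-1}(1+2\lambda_i^2)^{-1}$. *)

(* Defs.v *)
From HB Require Import structures.
From mathcomp Require Import all_boot all_order all_algebra.
From mathcomp Require Import finmap.
From mathcomp Require Import all_classical all_reals all_analysis.

Set Implicit Arguments.
Unset Strict Implicit.
Unset Printing Implicit Defensive.

Import Order.TTheory GRing.Theory Num.Theory.
Import numFieldNormedType.Exports.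

Local Open Scope classical_set_scope.
Local Open Scope ring_scope.

Definition separable_space (T : topologicalType) : Prop :=
  exists S : set T, countable S /\ dense S.

Section Operators.
Context {R : realType} {H : normedModType R}.

Definition nonexpansive (S : H -> H) : Prop :=
  forall x y, `|S x - S y| <= `|x - y|.

Definition fixpoints (S : H -> H) : set H := [set x | S x = x].

(* [inf] is the real infimum, meaningful because [F] is nonempty where used. *)
Definition dist (x : H) (F : set H) : R := inf [set `|x - p| | p in F].

End Operators.

Section Bochner.
Context {d : measure_display} {X : measurableType d} {R : realType}.
Context {H : normedModType R}.

Definition borel_measurable (f : X -> H) : Prop :=
  measurable_fun [set: X] (f : X -> g_sigma_algebraType (@open H)).

Definition simple (s : X -> H) : Prop :=
  finite_set (range s) /\ forall y, measurable (s @^-1` [set y]).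

(* [fine] loses nothing, since a probability only takes finite values. *)
Definition simple_integral (mu : probability X R) (s : X -> H) : H :=
  \sum_(y \in range s) fine (mu (s @^-1` [set y])) *: y.

Definition strongly_measurable (mu : probability X R) (f : X -> H) : Prop :=
  exists s : nat -> X -> H,
    (forall n, simple (s n)) /\ {ae mu, forall t, s n t @[n --> \oo] --> f t}.

Definition L1_approx (mu : probability X R) (f : X -> H)
    (s : nat -> X -> H) : Prop :=
  (forall n, simple (s n)) /\
  (\int[mu]_t (`|f t - s n t|)%:E)%E @[n --> \oo] --> 0%E.

Definition bochner_integrable (mu : probability X R) (f : X -> H) : Prop :=
  strongly_measurable mu f /\ exists s, L1_approx mu f s.

(* The limit of the integrals of an approximating sequence of simple functions;
   for an integrable [f] with values in a complete space it exists and does not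
   depend on the sequence.  The value is unspecified when no limit exists. *)
Definition bochner_integral (mu : probability X R) (f : X -> H) : H :=
  get [set v | exists2 s, L1_approx mu f s &
                 simple_integral mu (s n) @[n --> \oo] --> v].

End Bochner.

(* Mutual independence: the product rule for every finite subfamily. *)
Definition independent {I : choiceType} {d d' : measure_display}
    {Omega : measurableType d} {X : measurableType d'} {R : realType}
    (P : probability Omega R) (xi : I -> {RV P >-> X}) : Prop :=
  forall (J : {fset I}) (A : I -> set X), (forall i, measurable (A i)) ->
    (P (\bigcap_(i in [set` J]) xi i @^-1` A i) =
     \prod_(i <- J) P (xi i @^-1` A i))%E.

Section StochasticKM.
Context {R : realType}.

(* The iterates along a sample path [xi : nat -> X]. *)
Fixpoint skm {X : Type} {H : normedModType R} (T : X -> H -> H)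
    (lambda : nat -> R) (x0 : H) (xi : nat -> X) (k : nat) : H :=
  if k is k'.+1 then
    let x := skm T lambda x0 xi k' in
    (1 - lambda k') *: x + lambda k' *: T (xi k') x
  else x0.

Definition Lam (lambda : nat -> R) (k : nat) : R :=
  \prod_(0 <= i < k) (1 + 2 * lambda i ^+ 2)^-1.

Definition Q (lambda : nat -> R) (K : nat) : R :=
  (\sum_(0 <= k < K) Lam lambda k.+1 * (lambda k * (1 - lambda k)) *
     \sum_(k <= i < K) lambda i ^+ 2) /
  (\sum_(0 <= k < K) Lam lambda k.+1 * (lambda k * (1 - lambda k))).

End StochasticKM.

(* Main.v *)
(** For a fixed point p of the mean operator T, the noise T_xi p - p has mean zero.
    Expanding squares in the Hilbert space gives, for every deterministic x, a
    descent inequality for the expected square distance to p, whose defect is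
    the residual |Tx - x|^2; weighting it with Lambda and summing bounds both
    E|x_k - p|^2 and the weighted sum of the expected residuals.
    For the last iterate, run from x_k the noiseless iteration
    v_{i+1} = (1 - lambda_i) v_i + lambda_i T v_i.  Its residual is
    nonincreasing, its step is nonexpansive, and the noise has conditional mean
    zero, so that E|x_K - v_K|^2 is at most the sum over k <= i < K of
    lambda_i^2 E|(T_xi - T) x_i|^2.  Hence E|Tx_K - x_K|^2 is bounded by
    2 E|Tx_k - x_k|^2 plus a multiple of that sum, and averaging over k with the
    weights Lambda_{k+1} lambda_k (1 - lambda_k) gives the rate.
    The bound holds for every p because the variance of the noise is the same at
    all fixed points; the distance appears by taking the infimum over p.
    The Bochner integral enters only through its pairings with vectors of H, and
    conditioning on x_k is Fubini's theorem for the law of (x_k, xi_k). *)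

Require Import Defs.
From HB Require Import structures.
From mathcomp Require Import all_boot all_order all_algebra.
From mathcomp Require Import finmap.
From mathcomp Require Import all_classical all_reals all_analysis.
From mathcomp Require Import measurable_realfun.
From mathcomp Require Import ring lra.

Set Implicit Arguments.
Unset Strict Implicit.
Unset Printing Implicit Defensive.

Import Order.TTheory GRing.Theory Num.Theory.
Import numFieldNormedType.Exports.

Local Open Scope classical_set_scope.
Local Open Scope ring_scope.

(** * Inner products *)

Section InnerProduct.
Context (R : realType) (H : completeNormedModType R) (dotp : {dot H for idfun}).
Hypothesis norm_dotp : forall x : H, dotp x x = `|x| ^+ 2.

Lemma dotpC x y : dotp x y = dotp y x.
Proof. by rewrite hermC expr0 mul1r. Qed.

Lemma dotpDl x y z : dotp (x + y) z = dotp x z + dotp y z.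
Proof. exact: linearDl. Qed.

Lemma dotpDr z x y : dotp z (x + y) = dotp z x + dotp z y.
Proof. exact: linearDr. Qed.

Lemma dotpNl x z : dotp (- x) z = - dotp x z.
Proof. exact: linearNl. Qed.

Lemma dotpNr x z : dotp z (- x) = - dotp z x.
Proof. exact: linearNr. Qed.

Lemma dotpZl a x z : dotp (a *: x) z = a * dotp x z.
Proof. exact: linearZl_LR. Qed.

Lemma dotpZr a x z : dotp z (a *: x) = a * dotp z x.
Proof. by rewrite dotpC dotpZl dotpC. Qed.

Lemma dotp_sumr I (r : seq I) (F : I -> H) z :
  dotp z (\sum_(i <- r) F i) = \sum_(i <- r) dotp z (F i).
Proof. exact: linear_sumr. Qed.

Definition dotpE := (dotpDl, dotpDr, dotpNl, dotpNr, dotpZl, dotpZr).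

(** Cauchy-Schwarz follows from the triangle inequality of the given norm, by comparing the
    expansions of the two squares. *)
Lemma dotp_le_norm x y : dotp x y <= `|x| * `|y|.
Proof.
have : `|x + y| ^+ 2 <= (`|x| + `|y|) ^+ 2.
  by rewrite ler_sqr ?nnegrE ?addr_ge0// ler_normD.
rewrite -norm_dotp !dotpE !norm_dotp (dotpC y x); lra.
Qed.

Lemma norm_dotp_le x y : `|dotp x y| <= `|x| * `|y|.
Proof.
rewrite ler_norml dotp_le_norm andbT lerNl -dotpNl.
by rewrite (le_trans (dotp_le_norm _ _))// normrN.
Qed.

(* Linear identities between vectors are proved below by pairing both sides with
   an arbitrary [u], which turns them into ring identities. *)
Lemma dotp_inj x y : (forall u, dotp u x = dotp u y) -> x = y.
Proof.
move=> xy; apply/eqP; rewrite -subr_eq0 -normr_eq0 -sqrf_eq0 -norm_dotp.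
by rewrite dotpDr dotpNr xy subrr.
Qed.

End InnerProduct.

(** * Inequalities for one step at a fixed sample *)

Section PointwiseEstimates.
Context (R : realType) (H : completeNormedModType R) (dotp : {dot H for idfun}).
Hypothesis norm_dotp : forall x : H, dotp x x = `|x| ^+ 2.

(** Used with [w = x - p], [u = T t x - T t p], [e = T t p - p] and [g = x - ET x], the mean of
    [w - u]. The term [- |w - u|^2] is replaced by its tangent at [g], so that only [|e|^2] is not
    affine in the random vectors. The slack is exactly the sum of the three nonnegative terms in the
    proof. *)
Lemma descent_pointwise (l : R) (w u e g : H) :
  0 < l < 1 -> `|u| <= `|w| ->
  `|(1 - l) *: w + l *: (u + e)| ^+ 2 <=
  (1 + l ^+ 2) * `|w| ^+ 2 + 2 * l ^+ 2 * `|e| ^+ 2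
  + l * (1 - l) * `|g| ^+ 2
  + 2 * l * (1 - l) * dotp w e - 2 * l * (1 - l) * dotp g (w - u).
Proof.
move=> /andP[l0 l1] uw.
have uw2 : `|u| ^+ 2 <= `|w| ^+ 2 by rewrite ler_sqr ?nnegrE.
have h1 : 0 <= l * (1 - l) * `|w - u - g| ^+ 2.
  by rewrite mulr_ge0 ?sqr_ge0// mulr_ge0 ?subr_ge0 ?ltW.
have h2 : 0 <= l ^+ 2 * `|u - e| ^+ 2 by rewrite mulr_ge0 ?sqr_ge0.
have h3 : 0 <= (l + l ^+ 2) * (`|w| ^+ 2 - `|u| ^+ 2).
  by rewrite mulr_ge0 ?subr_ge0// addr_ge0 ?sqr_ge0 ?ltW.
move: h1 h2 h3; rewrite -!norm_dotp !(dotpE dotp).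
rewrite (dotpC dotp u w) (dotpC dotp e w) (dotpC dotp e u) (dotpC dotp w g).
rewrite (dotpC dotp u g); lra.
Qed.

(** Used with the same [w], [u], [e], with [q = ET x - p] the mean of [u], and [s] a difference of
    two noiseless steps. The term linear in [s] then has mean zero, and the bracket comes from [|u -
    q + e|^2 <= 2 * |u - q|^2 + 2 * |e|^2]. *)
Lemma noise_pointwise (l : R) (s w u e q : H) :
  `|u| <= `|w| ->
  `|s + l *: (u - q + e)| ^+ 2 <=
  `|s| ^+ 2 + 2 * l * dotp s (u - q + e)
  + l ^+ 2 * (2 * `|w| ^+ 2 - 4 * dotp q u + 2 * `|q| ^+ 2 + 2 * `|e| ^+ 2).
Proof.
move=> uw.
have uw2 : `|u| ^+ 2 <= `|w| ^+ 2 by rewrite ler_sqr ?nnegrE.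
have h2 : 0 <= l ^+ 2 * `|u - q - e| ^+ 2 by rewrite mulr_ge0 ?sqr_ge0.
have h3 : 0 <= l ^+ 2 * (`|w| ^+ 2 - `|u| ^+ 2).
  by rewrite mulr_ge0 ?subr_ge0// sqr_ge0.
move: h2 h3; rewrite -!norm_dotp !(dotpE dotp).
rewrite (dotpC dotp u s) (dotpC dotp e s) (dotpC dotp q s) (dotpC dotp e u).
rewrite (dotpC dotp u q) (dotpC dotp e q); lra.
Qed.

Lemma sqr_norm_add_weighted (t : R) (a b : H) : 0 < t ->
  `|a + b| ^+ 2 <= (1 + t) * `|a| ^+ 2 + (1 + t^-1) * `|b| ^+ 2.
Proof.
move=> t0.
have h : 0 <= t^-1 * `|t *: a - b| ^+ 2.
  by rewrite mulr_ge0 ?sqr_ge0// invr_ge0 ltW.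
suff -> : (1 + t) * `|a| ^+ 2 + (1 + t^-1) * `|b| ^+ 2 =
  `|a + b| ^+ 2 + t^-1 * `|t *: a - b| ^+ 2 by rewrite lerDl.
rewrite -!norm_dotp !(dotpE dotp) (dotpC dotp b a).
by field; rewrite gt_eqF.
Qed.

Lemma sqr_normB_le (w u q : H) :
  `|u| <= `|w| -> `|u - q| ^+ 2 <= `|w| ^+ 2 + `|q| ^+ 2 - 2 * dotp q u.
Proof.
move=> uw.
have uw2 : `|u| ^+ 2 <= `|w| ^+ 2 by rewrite ler_sqr ?nnegrE.
move: uw2; rewrite -!norm_dotp !(dotpE dotp) (dotpC dotp u q); lra.
Qed.

End PointwiseEstimates.

(** * Borel measurability in separable spaces *)

Lemma separable_dense_sequence (R : realType) (H : normedModType R) :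
  separable_space H ->
  exists a : nat -> H, forall x (e : R), 0 < e -> exists n, `|x - a n| < e.
Proof.
move=> [S [cS dS]].
have /pfcard_geP[S0|[g]] : (S #<= [set: nat])%card by [].
  have [|x []] := dS setT _ openT; first by exists 0.
  by rewrite S0.
exists g => x e e0.
have [|y [xy Sy]] := dS (ball x e) _ (ball_open x e).
  by exists x; exact: ballxx.
have [n _ gn] := @surj _ _ _ _ g _ Sy.
by exists n; rewrite gn; move: xy; rewrite -ball_normE.
Qed.

Section BorelMeasurability.
Context (R : realType) (H : completeNormedModType R).
Let HB := g_sigma_algebraType (@open H).
Hypothesis H_separable : separable_space H.
Context (d : measure_display) (X : measurableType d).

Lemma continuous_borel_measurable (g : H -> R) :
  continuous g -> measurable_fun [set: HB] (g : HB -> R).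
Proof.
move=> /continuousP cg; apply: (measurability _ (RGenInftyO.measurableE R)).
move=> _ [_ [a ->] <-]; rewrite setTI; apply: sub_gen_smallest.
by apply: cg; exact: interval_open.
Qed.

Lemma lipschitz_continuous (g : H -> R) (L : R) :
  (forall x y, g x <= g y + L * `|x - y|) -> continuous g.
Proof.
move=> Lg x; apply/cvgrPdist_lt => e e0; near=> y.
(* [L] carries no sign, and the 1 keeps the divisor positive. *)
have L0 : 0 < `|L| + 1 by rewrite ltr_wpDl.
have xy : (`|L| + 1) * `|x - y| < e.
  rewrite mulrC -ltr_pdivlMr//; near: y; apply: cvgr_dist_lt => //.
  by rewrite divr_gt0.
have LL z : L * z <= `|L| * z \/ z < 0.
  by case: (leP 0 z) => z0; [left; rewrite ler_wpM2r// ler_norm|right].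
have h1 := Lg x y; have h2 := Lg y x; rewrite (distrC y) in h2.
have n0 : 0 <= `|x - y| by [].
have [h3|] := LL `|x - y|; last by move=> h; rewrite ltNge n0 in h.
by rewrite ltr_norml; apply/andP; split; lra.
Unshelve. all: by end_near. Qed.

Lemma borel_measurable_norm (a : H) :
  measurable_fun [set: HB] ((fun x : H => `|x - a|) : HB -> R).
Proof.
apply: continuous_borel_measurable; apply: (@lipschitz_continuous _ 1) => x y.
by rewrite mul1r [leRHS]addrC ler_distD.
Qed.

Lemma borel_measurable_norm_comp (f : X -> H) (a : H) :
  borel_measurable f -> measurable_fun setT (fun t => `|f t - a|).
Proof. by move=> mf; exact: measurableT_comp (borel_measurable_norm a) mf. Qed.

(* In a separable space every open set is a countable union of balls centred on
   a dense sequence. *)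
Lemma borel_measurable_distP (f : X -> H) :
  (forall a, measurable_fun setT (fun t => `|f t - a|)) -> borel_measurable f.
Proof.
move=> mf; have [a aP] := separable_dense_sequence H_separable.
apply: (@measurability _ _ X HB setT f (@open H)) => // _ [U oU <-]; rewrite setTI.
pose N n m := [set t | `|f t - a n| < m.+1%:R^-1].
have -> : f @^-1` U =
    \bigcup_n \bigcup_(m in [set m | ball (a n) (m.+1%:R^-1) `<=` U]) N n m.
  apply/seteqP; split => [t Uft|t [n _ [m /= bU]]]; last first.
    rewrite /N/= => nft; apply: bU; rewrite -ball_normE /=.
    by rewrite distrC.
  have /nbhs_ballP[e /= e0 eU] : nbhs (f t) U by apply: open_nbhs_nbhs.
  have [m me] : exists m : nat, m.+1%:R^-1 < e / 2.
    have [|m] := @ltr_add_invr _ (0 : R) (e / 2); first by rewrite divr_gt0.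
    by rewrite add0r; exists m.
  have [|n nft] := aP (f t) (m.+1%:R^-1); first by [].
  exists n => //; exists m => //= y; rewrite -ball_normE /= => ny.
  apply: eU; rewrite -ball_normE /= (le_lt_trans (ler_distD (a n) _ _))//.
  by rewrite [e]splitr ltrD// ?(lt_trans nft) ?(lt_trans ny).
apply: bigcup_measurable => n _; apply: bigcup_measurable => m _.
rewrite /N -preimage_itvNyo -[_ @^-1` _]setTI.
by apply: mf => //; exact: measurable_itv.
Qed.

(* Along a dense sequence [a], [phi t x] is the infimum over [n] of
   [phi t (a n) + L * `|x - a n|]. *)
Lemma lipschitz_caratheodory (phi : X -> H -> R) (L : R) :
  0 <= L ->
  (forall t x y, phi t x <= phi t y + L * `|x - y|) ->
  (forall x, measurable_fun setT (phi ^~ x)) ->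
  measurable_fun setT (fun z : HB * X => phi z.2 z.1).
Proof.
move=> L0 Lphi mphi; have [a aP] := separable_dense_sequence H_separable.
apply: (measurability _ (RGenInftyO.measurableE R)).
move=> _ [_ [c ->] <-]; rewrite setTI preimage_itvNyo.
pose psi n (z : HB * X) := phi z.2 (a n) + L * `|(z.1 : H) - a n|.
rewrite (_ : [set _ | _] = \bigcup_n [set z | psi n z < c]).
  apply: bigcup_measurable => n _; rewrite -preimage_itvNyo -[_ @^-1` _]setTI.
  suff mpsi : measurable_fun setT (psi n) by apply: mpsi => //; exact: measurable_itv.
  apply: measurable_funD.
    exact: (measurableT_comp (mphi (a n)) measurable_snd).
  apply: measurable_funM => //.
  exact: (measurableT_comp (borel_measurable_norm (a n)) measurable_fst).
apply/seteqP; split => [[x t]/= xc|[x t] [n _] /=]; last first.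
  by apply: le_lt_trans; exact: Lphi.
(* Moving from [x] to [a n] costs [L * |x - a n|] twice, once in [phi] and once in the penalty,
   hence [2 * L]; the 1 covers [L = 0]. *)
have [|n xn] := aP x ((c - phi t x) / (2 * L + 1)).
  by rewrite divr_gt0 ?subr_gt0// ltr_wpDl// mulr_ge0.
exists n => //=; rewrite /psi /=.
move: xn; rewrite ltr_pdivlMr; last by rewrite ltr_wpDl// mulr_ge0.
have := Lphi t (a n) x; rewrite distrC.
have : 0 <= `|x - a n| by []. 
nra.
Qed.

End BorelMeasurability.

(** Distances to fixed points detect Borel measurability, and [|h t x - a|] is 1-Lipschitz in [x].
    Tonelli's theorem needs this joint measurability for a random operator applied to a random
    point. *)
Lemma lipschitz_caratheodory_borel (R : realType) (H : completeNormedModType R)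
    (H_separable : separable_space H)
    (d : measure_display) (X : measurableType d) (h : X -> H -> H) :
  (forall t, nonexpansive (h t)) ->
  (forall x, borel_measurable (h ^~ x)) ->
  borel_measurable (fun z : g_sigma_algebraType (@open H) * X => h z.2 z.1).
Proof.
move=> hne mh; apply: borel_measurable_distP => // a.
apply: (@lipschitz_caratheodory _ _ H_separable _ _
  (fun t x => `|h t x - a|) 1) => // [t x y|x]; last first.
  exact: borel_measurable_norm_comp.
by rewrite mul1r (le_trans (ler_distD (h t y) _ _))// addrC lerD2l hne.
Qed.

(** * Bochner integrals *)

Section BochnerDotp.
Context (R : realType) (H : completeNormedModType R) (dotp : {dot H for idfun}).
Hypothesis norm_dotp : forall x : H, dotp x x = `|x| ^+ 2.
Context (d : measure_display) (X : measurableType d) (mu : probability X R).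

Lemma measurable_dotp (u : H) (f : X -> H) :
  borel_measurable f -> measurable_fun setT (fun t => dotp u (f t)).
Proof.
move=> mf.
apply: (measurableT_comp (f := dotp u : g_sigma_algebraType (@open H) -> R)) => //.
apply: continuous_borel_measurable.
apply: (@lipschitz_continuous _ _ _ `|u|) => x y.
by rewrite -lerBlDl -dotpNr -dotpDr; exact: dotp_le_norm.
Qed.

(** The domain splits into finitely many measurable pieces on which [s] is constant. This makes
    [|f - s|] measurable without treating [f - s] as a vector-valued function. *)
Lemma simple_measurable_diag (s : X -> H) (G : H -> X -> R) :
  simple s -> (forall y, measurable_fun setT (G y)) ->
  measurable_fun setT (fun t => G (s t) t).
Proof.
move=> [fs ms] mG _ B mB; rewrite setTI.
rewrite (_ : _ @^-1` B =
    \bigcup_(y in range s) (s @^-1` [set y] `&` G y @^-1` B)).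
  apply: fin_bigcup_measurable => // y _; apply: measurableI; first exact: ms.
  by rewrite -[_ @^-1` B]setTI; exact: mG.
apply/seteqP; split => [t /= Bt|t [y _ [/= <-]]//].
by exists (s t) => //; exists t.
Qed.

Lemma simple_integral_dotp (s : X -> H) (u : H) : simple s ->
  mu.-integrable setT (fun t => (dotp u (s t))%:E) /\
  (\int[mu]_t (dotp u (s t))%:E = (dotp u (simple_integral mu s))%:E)%E.
Proof.
move=> [fs ms].
pose c y t : \bar R := ((dotp u y)%:E * (\1_(s @^-1` [set y]) t)%:E)%E.
have sE : (fun t => (dotp u (s t))%:E) =
    (fun t => \sum_(y <- fset_set (range s)) c y t)%E.
  apply/funext => t /=.
  have st : s t \in fset_set (range s) by rewrite in_fset_set// inE; exists t.
  rewrite (bigD1_seq (s t)) ?fset_uniq//= big1 ?adde0.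
    by rewrite /c indicE mem_set ?mule1.
  move=> y yst; rewrite /c indicE memNset ?mule0// => /= E.
  by rewrite E eqxx in yst.
have ic y : mu.-integrable setT (c y).
  by apply: integrableZl => //; exact: integrable_indic.
split; first by rewrite sE; exact: integrable_sum.
rewrite sE integral_sum// /simple_integral fsbig_finite//=.
rewrite dotp_sumr -sumEFin.
apply: eq_bigr => y _; rewrite integralZl//; last exact: integrable_indic.
rewrite integral_indic// setIT dotpZr mulrC EFinM fineK//.
exact: fin_num_measure.
Qed.

(** Write [f] as [(f - s) + s]: by Cauchy-Schwarz the first part is dominated by [|u| * |f - s|],
    and the second is integrated exactly. *)
Let dotp_approx (f : X -> H) (s : X -> H) (u : H) :
  borel_measurable f -> simple s ->
  (\int[mu]_t (`|f t - s t|)%:E < +oo)%E ->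
  mu.-integrable setT (fun t => (dotp u (f t))%:E) /\
  (`|\int[mu]_t (dotp u (f t))%:E - (dotp u (simple_integral mu s))%:E| <=
   (`|u|)%:E * \int[mu]_t (`|f t - s t|)%:E)%E.
Proof.
move=> mf ss fin.
have mfs : measurable_fun setT (fun t => `|f t - s t|).
  apply: (simple_measurable_diag (G := fun y t => `|f t - y|)) => // y.
  exact: borel_measurable_norm_comp.
have cdot := measurable_dotp u mf.
have [iS sE] := simple_integral_dotp u ss.
have ifs : mu.-integrable setT (fun t => (`|f t - s t|)%:E).
  apply/integrableP; split; first exact/measurable_EFinP.
  by under eq_integral do rewrite gee0_abs//.
have idfs : mu.-integrable setT (fun t => (dotp u (f t - s t))%:E).
  apply: (@le_integrable _ _ _ _ _ _ _
    (fun t => (`|u|)%:E * (`|f t - s t|)%:E)%E) => //.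
  - apply/measurable_EFinP; under eq_fun do rewrite dotpDr dotpNr.
    apply: measurable_funB => //.
    by apply/measurable_EFinP; exact: measurable_int iS.
  - move=> t _ /=; rewrite lee_fin normrM !normr_id.
    exact: norm_dotp_le.
  - exact: integrableZl.
have fE : (fun t => (dotp u (f t))%:E) =
    ((fun t => (dotp u (f t - s t))%:E) \+ (fun t => (dotp u (s t))%:E))%E.
  by apply/funext => t /=; rewrite -EFinD -dotpDr subrK.
split; first by rewrite fE; exact: integrableD.
rewrite fE integralD// sE addeK//.
apply: (le_trans (le_abse_integral _ _ _)) => //.
  exact: measurable_int idfs.
rewrite -integralZl//; apply: ge0_le_integral => //.
- by apply: measurableT_comp => //; exact: measurable_int idfs.
- by apply: measurable_funeM; exact/measurable_EFinP.
- by move=> t _ /=; rewrite lee_fin; exact: norm_dotp_le.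
Qed.

Let L1_approx_near (f : X -> H) (s : nat -> X -> H) (e : R) : L1_approx mu f s ->
  0 < e -> \forall n \near \oo, (\int[mu]_t (`|f t - s n t|)%:E < e%:E)%E.
Proof.
move=> [_ /fine_cvgP[fin cvg0]] e0.
have /cvgrPdist_lt/(_ _ e0) := cvg0; apply: filterS2 fin => n fn /= ne.
by rewrite -(fineK fn) lte_fin (le_lt_trans (ler_norm _))// -normrN -sub0r.
Qed.

(** The rank beyond which the bound holds does not depend on [u], so [u] may afterwards be built
    from the approximations themselves. *)
Let dotp_approx_le (f : X -> H) (s : nat -> X -> H) (e : R) :
  borel_measurable f -> L1_approx mu f s -> 0 < e ->
  \forall n \near \oo, forall u,
    `|fine (\int[mu]_t (dotp u (f t))%:E) - dotp u (simple_integral mu (s n))|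
      <= `|u| * e.
Proof.
move=> mf sf e0; apply: filterS (L1_approx_near sf e0) => n ne u.
have [idf] := dotp_approx u mf (sf.1 n) (lt_trans ne (ltry _)).
have /fineK fin := integrable_fin_num measurableT idf.
rewrite -[X in `|X - _|%E]fin -EFinB /= => h.
rewrite -lee_fin EFinM (le_trans h)//.
by apply: lee_wpmul2l; rewrite ?lee_fin// ltW.
Qed.

(* The integrals of the simple functions form a Cauchy sequence: pair the
   difference [w] of two of them with [w] itself. *)
Lemma bochner_integral_approx (f : X -> H) :
  borel_measurable f -> bochner_integrable mu f ->
  exists2 s, L1_approx mu f s &
    simple_integral mu (s n) @[n --> \oo] --> bochner_integral mu f.
Proof.
move=> mf [_ [s sf]].
suff /cauchy_cvgP/cvg_ex[v Iv] : cauchy (simple_integral mu (s n) @[n --> \oo]).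
  have [t ft It] := @getPex _ [set v | exists2 s, L1_approx mu f s &
     simple_integral mu (s n) @[n --> \oo] --> v]
     (ex_intro _ v (ex_intro2 _ _ s sf Iv)).
  by exists t.
apply/cauchyP => e e0.
(* Two errors of [|w| * (e / 3)] give [|w| <= 2 * e / 3], strictly below [e]. *)
have e3 : 0 < e / 3 by rewrite divr_gt0.
have [N _ NP] := dotp_approx_le mf sf e3.
exists (simple_integral mu (s N)); exists N => // n /= Nn.
rewrite -ball_normE /=.
set w := _ - _.
have := NP _ (leqnn N) w; have := NP _ Nn w.
set J := fine _; rewrite !ler_norml => /andP[h1 h2] /andP[h3 h4].
have : `|w| ^+ 2 <= `|w| * (2 * (e / 3)).
  rewrite -norm_dotp {2}/w dotpDr dotpNr; lra.
rewrite expr2; case: (eqVneq w 0) => [->|w0]; first by rewrite normr0.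
rewrite ler_pM2l ?normr_gt0//; lra.
Qed.

(** Both sides are limits of [dotp u (simple_integral mu (s n))]: one by L1 approximation, the other
    by continuity of the pairing. *)
Lemma bochner_integral_dotp (f : X -> H) (u : H) :
  borel_measurable f -> bochner_integrable mu f ->
  mu.-integrable setT (fun t => (dotp u (f t))%:E) /\
  (\int[mu]_t (dotp u (f t))%:E = (dotp u (bochner_integral mu f))%:E)%E.
Proof.
move=> mf bf; have [s sf Is] := bochner_integral_approx mf bf.
have idf : mu.-integrable setT (fun t => (dotp u (f t))%:E).
  have [n _ /(_ _ (leqnn n)) /= h] := L1_approx_near sf ltr01.
  by have [] := dotp_approx u mf (sf.1 n) (lt_trans h (ltry _)).
split => //.
have /fineK <- := integrable_fin_num measurableT idf.
congr EFin; apply/eqP; rewrite -subr_eq0 -normr_le0; apply/ler_addgt0Pr => e e0.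
rewrite add0r.
(* [|u|] times this number is at most [e / 2]; the added 1 covers [u = 0]. *)
have e2 : 0 < e / (2 * (`|u| + 1)) by rewrite divr_gt0// mulr_gt0// ltr_wpDl.
have /cvgrPdist_lt/(_ _ e2) := Is.
have := dotp_approx_le mf sf e2.
move=> /filterI /[apply] -[n _ /(_ _ (leqnn n)) /= [/(_ u) h1 h2]].
have h3 : `|u| * (e / (2 * (`|u| + 1))) <= e / 2.
  rewrite mulrA ler_pdivrMr; last by rewrite mulr_gt0// ltr_wpDl.
  by rewrite mulrA divfK// mulrC ler_pM2l// lerDl.
have h4 := norm_dotp_le norm_dotp u (bochner_integral mu f - simple_integral mu (s n)).
have h5 : `|u| * `|bochner_integral mu f - simple_integral mu (s n)| <= e / 2.
  by apply: le_trans h3; rewrite ler_wpM2l// ltW.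
rewrite dotpDr dotpNr in h4.
move: h1 h4; set J := fine _.
move=> h1; rewrite distrC => h4.
rewrite (le_trans (ler_distD (dotp u (simple_integral mu (s n))) _ _))//.
by rewrite [e]splitr lerD ?(le_trans h1) ?(le_trans h4).
Qed.

End BochnerDotp.

(** * Krasnoselskii-Mann steps of a random operator *)

Definition km_step (R : realType) (H : normedModType R)
    (l : R) (S : H -> H) (x : H) : H :=
  (1 - l) *: x + l *: S x.

Lemma km_step_nonexpansive (R : realType) (H : normedModType R) (l : R) (S : H -> H) :
  0 < l < 1 -> nonexpansive S -> nonexpansive (km_step l S).
Proof.
move=> /andP[l0 l1] Sne x y; rewrite /km_step opprD addrACA -!scalerBr.
rewrite (le_trans (ler_normD _ _))// !normrZ (gtr0_norm l0) gtr0_norm ?subr_gt0//.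
rewrite [leRHS](_ : _ = (1 - l) * `|x - y| + l * `|x - y|); last by ring.
by rewrite lerD2l ler_wpM2l// ltW.
Qed.

(** With [v = km_step l S x], split [S v - v] at [S x]: nonexpansiveness bounds [|S v - S x|] by
    [l * |S x - x|], and [|S x - v|] equals [(1 - l) * |S x - x|]. *)
Lemma km_step_residual (R : realType) (H : normedModType R) (l : R) (S : H -> H)
    (x : H) : 0 < l < 1 -> nonexpansive S ->
  `|S (km_step l S x) - km_step l S x| <= `|S x - x|.
Proof.
move=> /andP[l0 l1] Sne; rewrite (le_trans (ler_distD (S x) _ _))//.
have e1 : km_step l S x - x = l *: (S x - x).
  rewrite /km_step scalerBl scale1r scalerBr addrAC [_ - _ - _]addrAC subrr.
  by rewrite add0r addrC.
have e2 : S x - km_step l S x = (1 - l) *: (S x - x).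
  by rewrite -[km_step l S x](subrK x) e1 opprD addrA addrAC scalerBl scale1r.
have := Sne (km_step l S x) x; rewrite e1 e2 !normrZ (gtr0_norm l0).
rewrite (gtr0_norm (_ : 0 < 1 - l)) ?subr_gt0//; lra.
Qed.

Lemma km_step_borel_measurable (R : realType) (H : completeNormedModType R)
    (H_separable : separable_space H) (d : measure_display) (X : measurableType d)
    (T : X -> H -> H) (l : R) (x : H) :
  borel_measurable (T ^~ x) -> borel_measurable (fun t => km_step l (T t) x).
Proof.
move=> mT; apply: borel_measurable_distP => // a.
pose g y := `|(1 - l) *: x + l *: y - a|.
apply: (measurableT_comp (f := g : g_sigma_algebraType (@open H) -> R)); last exact: mT.
apply: continuous_borel_measurable; apply: (@lipschitz_continuous _ _ _ `|l|) => y z.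
rewrite -normrZ /g -lerBlDl (le_trans (lerB_dist _ _))//.
rewrite [X in `|X|](_ : _ = l *: (y - z))//.
by rewrite opprB subrKA opprD addrACA subrr add0r scalerBr.
Qed.

Section AveragedOperator.
Context (R : realType) (H : completeNormedModType R) (dotp : {dot H for idfun}).
Hypothesis norm_dotp : forall x : H, dotp x x = `|x| ^+ 2.
Hypothesis H_separable : separable_space H.
Context (d : measure_display) (X : measurableType d) (D : probability X R).
Context (T : X -> H -> H) (ET : H -> H).
Hypothesis T_ne : forall t, nonexpansive (T t).
Hypothesis T_meas : forall x, borel_measurable (T ^~ x).
Hypothesis T_int : forall u x, D.-integrable setT (fun t => (dotp u (T t x))%:E).
Hypothesis T_dot :
  forall u x, (\int[D]_t (dotp u (T t x))%:E = (dotp u (ET x))%:E)%E.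

(** Pair with [w = ET x - ET y] itself: [|w|^2] is the mean of [dotp w (T t x - T t y)], which is at
    most [|w| * |x - y|]. *)
Lemma mean_nonexpansive : nonexpansive ET.
Proof.
move=> x y; set w := ET x - ET y.
have : ((dotp w (ET x))%:E <= (dotp w (ET y) + `|w| * `|x - y|)%:E)%E.
  rewrite EFinD -!T_dot.
  have -> : (`|w| * `|x - y|)%:E = (\int[D]_t (cst (`|w| * `|x - y|)%:E t))%E.
    by rewrite integral_cst// [X in (_ * X)%E](@probability_setT _ _ _ D) mule1.
  rewrite -integralD//; last exact: finite_measure_integrable_cst.
  apply: le_integral => //.
    by apply: integrableD => //; exact: finite_measure_integrable_cst.
  move=> t _ /=; rewrite lee_fin -lerBlDl -dotpNr -dotpDr.
  rewrite (le_trans (dotp_le_norm norm_dotp _ _))// ler_wpM2l//; exact: T_ne.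
rewrite lee_fin -lerBlDl -dotpNr -dotpDr -/w norm_dotp expr2.
have [->|w0] := eqVneq w 0; first by rewrite normr0.
by rewrite ler_pM2l ?normr_gt0.
Qed.

(** The common shape of the one-step bounds: the only random terms are the squared noise at a
    reference point and linear functionals, whose means [T_dot] provides. *)
Lemma integral_le_affine (F : X -> R) (s2 C c : R) (q v x w y : H) :
  measurable_fun setT F -> (forall t, 0 <= F t) ->
  (\int[D]_t (`|T t q - q| ^+ 2)%:E <= s2%:E)%E -> 0 <= c ->
  (forall t, F t <= C + c * `|T t q - q| ^+ 2 + dotp v (T t x) + dotp w (T t y)) ->
  (\int[D]_t (F t)%:E <= (C + c * s2 + dotp v (ET x) + dotp w (ET y))%:E)%E.
Proof.
move=> mF F0 qs2 c0 FG.
have iq : D.-integrable setT (fun t => (`|T t q - q| ^+ 2)%:E).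
  apply/integrableP; split.
    by apply/measurable_EFinP/measurable_funX; exact: borel_measurable_norm_comp.
  under eq_integral do rewrite gee0_abs ?lee_fin ?sqr_ge0//.
  by rewrite (le_lt_trans qs2)// ltry.
have icst := @finite_measure_integrable_cst _ _ _ D setT C measurableT.
pose G t := (C%:E + c%:E * (`|T t q - q| ^+ 2)%:E + (dotp v (T t x))%:E
  + (dotp w (T t y))%:E)%E.
have i1 : D.-integrable setT (fun t => C%:E + c%:E * (`|T t q - q| ^+ 2)%:E)%E.
  by apply: integrableD => //; exact: integrableZl.
have i2 : D.-integrable setT
    (fun t => C%:E + c%:E * (`|T t q - q| ^+ 2)%:E + (dotp v (T t x))%:E)%E.
  exact: integrableD.
have iG : D.-integrable setT G by exact: integrableD.
have FG' t : ((F t)%:E <= G t)%E by rewrite /G -EFinM -!EFinD lee_fin.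
apply: (@le_trans _ _ (\int[D]_t G t)%E).
  apply: ge0_le_integral => //; first by move=> t _; rewrite lee_fin.
    exact/measurable_EFinP.
  exact: measurable_int iG.
rewrite /G integralD// integralD// integralD//; last exact: integrableZl.
rewrite !T_dot integralZl// integral_cst//.
rewrite [X in (_ * X)%E](@probability_setT _ _ _ D) mule1.
by rewrite !EFinD leeD2r// leeD2r// leeD2l// EFinM lee_wpmul2l// lee_fin.
Qed.

(* [T t p - T t q] has mean [p - q] and norm at most [`|p - q|], so its variance
   vanishes; the weight [e] of [sqr_norm_add_weighted] then tends to 0. *)
Lemma variance_fix_le (p q : H) (s2 : R) : ET p = p -> ET q = q ->
  (\int[D]_t (`|T t q - q| ^+ 2)%:E <= s2%:E)%E ->
  (\int[D]_t (`|T t p - p| ^+ 2)%:E <= s2%:E)%E.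
Proof.
move=> Ep Eq qs2.
have s20 : 0 <= s2.
  by rewrite -lee_fin (le_trans _ qs2)// integral_ge0// => t _; rewrite lee_fin sqr_ge0.
suff h (e : R) : 0 < e -> (\int[D]_t (`|T t p - p| ^+ 2)%:E <= ((1 + e) * s2)%:E)%E.
  have fin : (\int[D]_t (`|T t p - p| ^+ 2)%:E)%E \is a fin_num.
    rewrite ge0_fin_numE; first by rewrite (le_lt_trans (h 1 _))// ltry.
    by apply: integral_ge0 => t _; rewrite lee_fin sqr_ge0.
  rewrite -(fineK fin) lee_fin; apply/ler_addgt0Pr => e e0.
  (* With this weight the excess over [s2] is at most [e]; the added 1 covers [s2 = 0]. *)
  have es : 0 < e / (s2 + 1) by rewrite divr_gt0// ltr_wpDl.
  have := h _ es; rewrite -(fineK fin) lee_fin => /le_trans; apply.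
  rewrite mulrDl mul1r lerD2l -mulrA ger_pMr// mulrC ler_pdivrMr ?mul1r ?lerDl//.
  by rewrite ltr_wpDl.
move=> e0; pose k := 1 + e^-1.
have k0 : 0 <= k by rewrite addr_ge0// invr_ge0 ltW.
(* The part with factor [k] is bounded by [2 * k * |p - q|^2] plus linear terms at [p] and [q].
   Since both points are fixed, the means of the linear terms cancel that constant. *)
have := @integral_le_affine (fun t => `|T t p - p| ^+ 2) s2
  (2 * k * `|p - q| ^+ 2) (1 + e) q
  ((- (2 * k)) *: (p - q)) p ((2 * k) *: (p - q)) q.
rewrite !dotpZl Ep Eq -norm_dotp.
rewrite (_ : _ + _ + _ + _ = (1 + e) * s2); last by rewrite !(dotpE dotp); ring.
apply => //.
- by apply: measurable_funX; exact: borel_measurable_norm_comp.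
- by rewrite addr_ge0// ltW.
move=> t.
have -> : T t p - p = (T t q - q) + ((T t p - T t q) - (p - q)).
  by apply: (dotp_inj norm_dotp) => u; rewrite !(dotpE dotp); ring.
rewrite (le_trans (sqr_norm_add_weighted norm_dotp _ _ e0))//.
have := sqr_normB_le norm_dotp (p - q) (T_ne t p q); rewrite -/k => h.
have := ler_wpM2l k0 h; rewrite -(norm_dotp (p - q)) !(dotpE dotp); lra.
Qed.

Lemma descent_step (l : R) (x p : H) (s2 : R) : 0 < l < 1 -> ET p = p ->
  (\int[D]_t (`|T t p - p| ^+ 2)%:E <= s2%:E)%E ->
  (\int[D]_t (`|km_step l (T t) x - p| ^+ 2)%:E + (l * (1 - l) * `|ET x - x| ^+ 2)%:E
   <= ((1 + 2 * l ^+ 2) * `|x - p| ^+ 2 + 2 * l ^+ 2 * s2)%:E)%E.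
Proof.
move=> l01 Ep ps2.
have l2 : 0 <= l ^+ 2 by exact: sqr_ge0.
pose c := 2 * l * (1 - l).
have h : (\int[D]_t (`|km_step l (T t) x - p| ^+ 2)%:E <=
    ((1 + l ^+ 2) * `|x - p| ^+ 2 + l * (1 - l) * `|x - ET x| ^+ 2
      - c * dotp (x - p) p - c * dotp (x - ET x) (x - p)
     + 2 * l ^+ 2 * s2 + dotp (c *: (x - ET x)) (ET x)
     + dotp (c *: (x - p) - c *: (x - ET x)) (ET p))%:E)%E.
  apply: (integral_le_affine (q := p)) => //.
  - by apply: measurable_funX; apply: borel_measurable_norm_comp;
      exact: km_step_borel_measurable (T_meas x).
  - by rewrite mulr_ge0.
  move=> t.
  have -> : km_step l (T t) x - p =
      (1 - l) *: (x - p) + l *: ((T t x - T t p) + (T t p - p)).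
    by apply: (dotp_inj norm_dotp) => u; rewrite /km_step !(dotpE dotp); ring.
  apply: (le_trans (descent_pointwise norm_dotp (T t p - p) (x - ET x) l01
    (T_ne t x p))).
  rewrite /c !(dotpE dotp); lra.
rewrite -leeBrDr// -EFinB; apply: (le_trans h); rewrite lee_fin Ep.
rewrite (distrC (ET x)) -!norm_dotp /c.
(* The estimate so far has the factor [1 + l^2]; this slack brings it to [1 + 2 * l^2], the factor
   in [Lam]. *)
have : 0 <= l ^+ 2 * `|x - p| ^+ 2 by rewrite mulr_ge0.
rewrite -norm_dotp !(dotpE dotp) (dotpC dotp (ET x) x) (dotpC dotp p x).
rewrite (dotpC dotp (ET x) p); lra.
Qed.

Lemma noise_step (l : R) (x y p : H) (s2 : R) : 0 < l < 1 -> ET p = p ->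
  (\int[D]_t (`|T t p - p| ^+ 2)%:E <= s2%:E)%E ->
  (\int[D]_t (`|km_step l (T t) x - km_step l ET y| ^+ 2)%:E
   <= (`|x - y| ^+ 2 + l ^+ 2 * (2 * `|x - p| ^+ 2 + 2 * s2))%:E)%E.
Proof.
move=> l01 Ep ps2.
have l2 : 0 <= l ^+ 2 by exact: sqr_ge0.
set s := km_step l ET x - km_step l ET y.
have sxy : `|s| ^+ 2 <= `|x - y| ^+ 2.
  rewrite ler_sqr ?nnegrE//; apply: km_step_nonexpansive => //.
  exact: mean_nonexpansive.
set q := ET x - p.
have h : (\int[D]_t (`|km_step l (T t) x - km_step l ET y| ^+ 2)%:E <=
    (`|s| ^+ 2 - 2 * l * dotp s (ET x)
      + l ^+ 2 * (2 * `|x - p| ^+ 2 + 2 * `|q| ^+ 2)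
     + 2 * l ^+ 2 * s2
     + dotp ((2 * l) *: s - (4 * l ^+ 2) *: q) (ET x)
     + dotp ((4 * l ^+ 2) *: q) (ET p))%:E)%E.
  apply: (integral_le_affine (q := p)) => //.
  - by apply: measurable_funX; apply: borel_measurable_norm_comp;
      exact: km_step_borel_measurable (T_meas x).
  - by rewrite mulr_ge0.
  move=> t.
  have uqe : (T t x - T t p) - q + (T t p - p) = T t x - ET x.
    by apply: (dotp_inj norm_dotp) => u; rewrite /q !(dotpE dotp); ring.
  have -> : km_step l (T t) x - km_step l ET y =
      s + l *: ((T t x - T t p) - q + (T t p - p)).
    by apply: (dotp_inj norm_dotp) => u; rewrite uqe /s /km_step !(dotpE dotp); ring.
  apply: (le_trans (noise_pointwise norm_dotp l s (T t p - p) q (T_ne t x p))).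
  rewrite uqe; move: (s) (q) => s' q'; rewrite !(dotpE dotp); lra.
apply: (le_trans h); rewrite lee_fin Ep.
have qE : `|q| ^+ 2 = dotp q (ET x) - dotp q p.
  by rewrite -norm_dotp -dotpNr -dotpDr.
have := mulr_ge0 l2 (sqr_ge0 `|q|); rewrite qE.
move: sxy; move: (s) (q) => s' q'; rewrite !(dotpE dotp); lra.
Qed.

End AveragedOperator.

(** * Independence and Markov chains *)

Section Independence.
Context (R : realType) (d' : measure_display) (Omega : measurableType d').
Context (P : probability Omega R).
Context (d1 d2 : measure_display) (T1 : measurableType d1) (T2 : measurableType d2).
Context (Y : {mfun Omega >-> T1}) (Z : {mfun Omega >-> T2}).

Let YZ := fun w => (Y w, Z w).
Let mYZ : measurable_fun setT YZ.
Proof. by apply: measurable_fun_pair; exact: measurable_funP. Qed.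

(* Both sides are finite measures of [C] that agree on the rectangles. *)
Lemma prob_pair_indep_event (E : set Omega) : measurable E ->
  (forall B A, measurable B -> measurable A ->
    P (Y @^-1` B `&` Z @^-1` A `&` E) = P (Y @^-1` B `&` Z @^-1` A) * P E)%E ->
  forall C, measurable C -> (P (YZ @^-1` C `&` E) = P (YZ @^-1` C) * P E)%E.
Proof.
move=> mE indep C mC.
have PE0 : 0 <= fine (P E) by exact: fine_ge0.
pose pf (m : {measure set Omega -> \bar R}) :=
  pushforward m YZ : {measure set (T1 * T2) -> \bar R}.
pose m1 := pf mYZ (mrestr P mE).
pose m2 : {measure set (T1 * T2) -> \bar R} := mscale (NngNum PE0) (pf mYZ P).
have m2E A : m2 A = (P (YZ @^-1` A) * P E)%E.
  rewrite [LHS](_ : _ = (fine (P E))%:E * P (YZ @^-1` A))%E//.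
  by rewrite fineK 1?muleC//; exact: fin_num_measure.
rewrite -m2E -[LHS]/(m1 C).
apply: (@measure_unique _ _ _ [set A `*` B | A in measurable & B in measurable]
  (fun=> setT)) => //.
- exact: measurable_prod_measurableType.
- move=> _ _ [A1 mA1 [B1 mB1 <-]] [A2 mA2 [B2 mB2 <-]].
  exists (A1 `&` A2); first exact: measurableI.
  exists (B1 `&` B2); first exact: measurableI.
  by rewrite setXI.
- move=> _; exists setT => //; exists setT => //.
  by rewrite -setXTT.
- by rewrite bigcup_const.
- by move=> _ [B mB [A mA <-]]; rewrite m2E; exact: indep.
- move=> _; rewrite -[X in (X < _)%E]/(P (setT `&` E)).
  by rewrite (le_lt_trans (probability_le1 _ _)) ?ltry// setTI.
Qed.

(** The law of the pair agrees with the product measure on rectangles, hence everywhere; Tonelli's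
    theorem then applies. *)
Lemma ge0_integral_indep_pair (D : probability T2 R) (f : T1 * T2 -> \bar R) :
  (forall B A, measurable B -> measurable A ->
    P (Y @^-1` B `&` Z @^-1` A) = P (Y @^-1` B) * D A)%E ->
  measurable_fun setT f -> (forall z, 0 <= f z)%E ->
  (\int[P]_w f (Y w, Z w) = \int[P]_w \int[D]_t f (Y w, t))%E.
Proof.
move=> indep mf f0.
pose YZm : {mfun Omega >-> (T1 * T2)%type} :=
  HB.pack YZ (isMeasurableFun.Build _ _ _ _ _ mYZ).
transitivity (\int[distribution P YZm]_z f z)%E.
  by rewrite ge0_integral_distribution.
transitivity (\int[distribution P Y \x D]_z f z)%E.
  apply: eq_measure_integral => C mC _; apply/esym.
  by apply: product_measure_unique => // B A mB mA; exact: indep.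
rewrite fubini_tonelli1// ge0_integral_distribution//.
  exact: measurable_fun_fubini_tonelli_F.
by move=> y; apply: integral_ge0.
Qed.

End Independence.

Section DrivenChain.
Context (R : realType) (dS : measure_display) (S : measurableType dS).
Context (d : measure_display) (X : measurableType d) (D : probability X R).
Context (step : nat -> S * X -> S).
Hypothesis step_measurable : forall k, measurable_fun setT (step k).
Context (x0 : S).
Context (d' : measure_display) (Omega : measurableType d') (P : probability Omega R).
Context (xi : nat -> {RV P >-> X}).
Hypothesis xi_law : forall k A, measurable A -> distribution P (xi k) A = D A.
Hypothesis xi_indep : independent xi.

(** The state space is arbitrary, so that both the iterates in [H] and the coupled pairs in [H * H]
    are instances. *)
Fixpoint driven_chain k (w : Omega) : S :=
  if k is k'.+1 then step k' (driven_chain k' w, xi k' w) else x0.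

Local Notation x := driven_chain.

Lemma driven_chain_measurable k : measurable_fun setT (x k).
Proof.
elim: k => [|k IH]; first exact: measurable_cst.
exact: (measurableT_comp (step_measurable k)
  (measurable_fun_pair IH (measurable_funP (xi k)))).
Qed.

Let xm k : {mfun Omega >-> S} :=
  HB.pack (x k) (isMeasurableFun.Build _ _ _ _ _ (driven_chain_measurable k)).

Let event (J : {fset nat}) (A : nat -> set X) := \bigcap_(i in [set` J]) xi i @^-1` A i.

Let measurable_event J A : (forall i, measurable (A i)) -> measurable (event J A).
Proof.
move=> mA; apply: fin_bigcap_measurable => // i _.
by rewrite -[_ @^-1` _]setTI; apply: measurable_funP.
Qed.

Let event_cons k (J : {fset nat}) A B : k \notin J ->
  event (k |` J)%fset (fun i => if i == k then B else A i) =
  xi k @^-1` B `&` event J A.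
Proof.
move=> kJ; apply/seteqP; split => [w wkJ|w [wk wJ] i /=].
  split; first by have := wkJ k; rewrite /= !inE eqxx; apply.
  move=> i /= iJ; have := wkJ i; rewrite /= !inE iJ orbT => /(_ isT).
  by case: eqP => // ik; move: kJ; rewrite -ik iJ.
by rewrite !inE; have [->|_ /= iJ] := eqVneq i k => //; exact: wJ.
Qed.

Let prob_event_cons k (J : {fset nat}) A B :
  k \notin J -> (forall i, measurable (A i)) ->
  measurable B ->
  (P (xi k @^-1` B `&` event J A) = D B * P (event J A))%E.
Proof.
move=> kJ mA mB; rewrite -event_cons// /event !xi_indep//; last first.
  by move=> i; case: ifP.
rewrite big_fsetU1//= eqxx; congr (_ * _)%E; first exact: xi_law.
rewrite big_seq [RHS]big_seq; apply: eq_bigr => i iJ.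
by case: eqP => // ik; move: kJ; rewrite -ik iJ.
Qed.

(** Induction on [k], with [J] general: [x k.+1] is a function of [x k] and [xi k], and the event on
    [xi k] is absorbed into the finite family of later draws. *)
Lemma driven_chain_indep_event k (J : {fset nat}) (A : nat -> set X) (B : set S) :
  (forall i, i \in J -> (k <= i)%N) ->
  (forall i, measurable (A i)) -> measurable B ->
  (P (x k @^-1` B `&` event J A) = P (x k @^-1` B) * P (event J A))%E.
Proof.
elim: k J A B => [|k IH] J A B kJ mA mB.
  have [x0B|x0B] := pselect (B x0).
    have -> : x 0%N @^-1` B = setT by apply/seteqP; split.
    by rewrite setTI probability_setT mul1e.
  have -> : x 0%N @^-1` B = set0 by apply/seteqP; split.
  by rewrite set0I measure0 mul0e.
have kNJ : k \notin J by apply/negP => /kJ; rewrite ltnn.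
have indep (C : set S) (F : set X) (J' : {fset nat}) :
    (forall i, i \in J' -> (k < i)%N) ->
    measurable C -> measurable F ->
    (P (x k @^-1` C `&` (xi k @^-1` F `&` event J' A)) =
     P (x k @^-1` C) * (D F * P (event J' A)))%E.
  move=> kJ' mC mF.
  have kNJ' : k \notin J' by apply/negP => /kJ'; rewrite ltnn.
  rewrite -(prob_event_cons kNJ' mA mF) -(event_cons _ _ kNJ') IH//.
    by move=> i; rewrite !inE => /orP[/eqP->//|/kJ'/ltnW].
  by move=> i; case: ifP.
have event0 : event fset0 A = setT.
  by apply/seteqP; split => // w _ i /=; rewrite inE.
have := @prob_pair_indep_event _ _ _ P _ _ _ _ (xm k) (xi k) (event J A)
  (measurable_event J mA) _ (step k @^-1` B).
apply => [C F mC mF|]; last first.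
  by rewrite -[_ @^-1` _]setTI; exact: step_measurable.
rewrite -setIA indep// muleA; congr (_ * _)%E.
(* With no later draws, [indep] says that [x k] and [xi k] are independent. *)
by have := indep C F fset0; rewrite event0 setIT probability_setT mule1 => ->.
Qed.

Lemma ge0_integral_driven_chain_succ k (f : S -> \bar R) :
  measurable_fun setT f -> (forall y, 0 <= f y)%E ->
  (\int[P]_w f (x k.+1 w) = \int[P]_w \int[D]_t f (step k (x k w, t)))%E.
Proof.
move=> mf f0.
apply: (@ge0_integral_indep_pair _ _ _ P _ _ _ _ (xm k) (xi k) D (f \o step k)) => //.
- move=> B A mB mA.
  have event1 : event [fset k]%fset (fun=> A) = xi k @^-1` A.
    apply/seteqP; split => [w /(_ k)|w wA i /=]; last by rewrite inE => /eqP->.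
    by rewrite /= inE eqxx; apply.
  have := @driven_chain_indep_event k [fset k]%fset (fun=> A) B.
  rewrite event1 => -> //; first by congr (_ * _)%E; exact: xi_law.
  by move=> i; rewrite inE => /eqP->.
- by apply: measurableT_comp => //; exact: step_measurable.
- by move=> z; exact: f0.
Qed.

End DrivenChain.

(** * Rates from recursive inequalities *)

Section RateFromRecursions.
Context (R : realType) (lambda : nat -> R).
Hypothesis lambda01 : forall k, 0 < lambda k < 1.

Lemma Lam_gt0 k : 0 < Lam lambda k.
Proof.
by apply: prodr_gt0 => i _; rewrite invr_gt0 ltr_wpDr// mulr_ge0// sqr_ge0.
Qed.

Lemma LamS k : Lam lambda k = (1 + 2 * lambda k ^+ 2) * Lam lambda k.+1.
Proof.
have l0 : 0 < 1 + 2 * lambda k ^+ 2 by rewrite ltr_wpDr// mulr_ge0// sqr_ge0.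
by rewrite /Lam big_nat_recr//= mulrCA divff ?mulr1 ?gt_eqF.
Qed.

Lemma Lam_nonincreasing m n : (m <= n)%N -> Lam lambda n <= Lam lambda m.
Proof.
elim: n => [|n IH]; first by rewrite leqn0 => /eqP->.
rewrite leq_eqVlt => /predU1P[->//|/IH]; apply: le_trans.
rewrite (LamS n); apply: ler_peMl; first exact: ltW (Lam_gt0 _).
by rewrite lerDl mulr_ge0// sqr_ge0.
Qed.

Lemma Lam_le1 n : Lam lambda n <= 1.
Proof.
by rewrite (le_trans (Lam_nonincreasing (leq0n n)))// /Lam big_geq.
Qed.

(** [A k] stands for the expected squared distance of [x k] to a fixed point, [G k] for its expected
    squared residual. *)
Context (A G : nat -> R) (s2 : R) (K : nat).
Hypothesis A_ge0 : forall k, 0 <= A k.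
Hypothesis G_ge0 : forall k, 0 <= G k.
Hypothesis s2_ge0 : 0 <= s2.
Hypothesis K_ge1 : (1 <= K)%N.
Hypothesis descent : forall k,
  A k.+1 + lambda k * (1 - lambda k) * G k <=
  (1 + 2 * lambda k ^+ 2) * A k + 2 * lambda k ^+ 2 * s2.
Hypothesis drift : forall k, (k <= K)%N ->
  G K <= 2 * G k + 8 * \sum_(k <= i < K) lambda i ^+ 2 * (2 * A i + 2 * s2).

Let weight k := Lam lambda k.+1 * (lambda k * (1 - lambda k)).
Let V n := A 0 + 2 * \sum_(0 <= k < n) lambda k ^+ 2 * s2.

Let l1l_gt0 k : 0 < lambda k * (1 - lambda k).
Proof. by have /andP[l0 l1] := lambda01 k; rewrite mulr_gt0// subr_gt0. Qed.

Let weight_gt0 k : 0 < weight k.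
Proof. by rewrite mulr_gt0 ?Lam_gt0. Qed.

(** Multiplied by [Lam lambda n.+1], the inequality [descent] telescopes by [LamS], and its noise
    term carries a weight at most 1. *)
Lemma weighted_descent n :
  Lam lambda n * A n + \sum_(0 <= k < n) weight k * G k <= V n.
Proof.
elim: n => [|n IH].
  by rewrite /V /Lam !big_geq// mul1r !addr0 mulr0 addr0.
have := ler_wpM2l (ltW (Lam_gt0 n.+1)) (descent n).
have l2s : 0 <= lambda n ^+ 2 * s2 by rewrite mulr_ge0// sqr_ge0.
have := ler_wpM2r l2s (Lam_le1 n.+1).
move: IH; rewrite /V !big_nat_recr//= /weight (LamS n); lra.
Qed.

Let V_le n : (n <= K)%N -> V n <= V K.
Proof.
move=> nK; rewrite lerD2l ler_pM2l// [leRHS](@big_cat_nat _ _ _ n)//= lerDl.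
by apply: sumr_ge0 => i _; rewrite mulr_ge0// sqr_ge0.
Qed.

Let A_le n : (n <= K)%N -> A n <= V K / Lam lambda K.
Proof.
move=> nK; have V0 : 0 <= V K.
  by rewrite addr_ge0// mulr_ge0// sumr_ge0// => i _; rewrite mulr_ge0// sqr_ge0.
rewrite ler_pdivlMr ?Lam_gt0//.
rewrite (le_trans _ (V_le nK))// (le_trans _ (weighted_descent n))//.
rewrite mulrC (le_trans (ler_wpM2r (A_ge0 n) (Lam_nonincreasing nK)))// lerDl.
by apply: sumr_ge0 => i _; rewrite mulr_ge0// ltW.
Qed.

(** The inequality [drift] is averaged over [k] with the weights. Every [A i] in it is at most [B],
    so each [2 * A i + 2 * s2] yields a factor 2 that turns 8 into 16. *)
Lemma rate_of_recursions :
  G K <= (16 * Q lambda K + 2 / (\sum_(0 <= k < K) lambda k * (1 - lambda k)))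
      * ((A 0 + 2 * \sum_(0 <= k < K) lambda k ^+ 2 * s2) / Lam lambda K)
    + 16 * Q lambda K * s2.
Proof.
rewrite -/(V K); set B := V K / Lam lambda K.
set S := \sum_(0 <= k < K) lambda k * (1 - lambda k).
pose W := \sum_(0 <= k < K) weight k.
pose N := \sum_(0 <= k < K) weight k * \sum_(k <= i < K) lambda i ^+ 2.
have QE : Q lambda K = N / W by [].
have sum_gt0 (F : nat -> R) : (forall k, 0 < F k) -> 0 < \sum_(0 <= k < K) F k.
  move=> F0; rewrite big_ltn// ltr_wpDr// ?sumr_ge0// => i _; exact: ltW.
have W0 : 0 < W by exact: sum_gt0.
have S0 : 0 < S by exact: sum_gt0.
have step k : (k < K)%N ->
    weight k * G K <= 2 * (weight k * G k)
      + 16 * (B + s2) * (weight k * \sum_(k <= i < K) lambda i ^+ 2).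
  move=> kK; have := ler_wpM2l (ltW (weight_gt0 k)) (drift (ltnW kK)).
  have : \sum_(k <= i < K) lambda i ^+ 2 * (2 * A i + 2 * s2) <=
      2 * (B + s2) * \sum_(k <= i < K) lambda i ^+ 2.
    rewrite mulr_sumr; apply: ler_sum_nat => i /andP[_ iK].
    rewrite mulrC ler_wpM2r ?sqr_ge0// mulrDr lerD2r ler_pM2l//.
    by apply: A_le; exact: ltnW.
  move=> /(ler_wpM2l (ltW (weight_gt0 k))); lra.
have : W * G K <= 2 * V K + 16 * (B + s2) * N.
  have : \sum_(0 <= k < K) weight k * G k <= V K.
    rewrite (le_trans _ (weighted_descent K))// lerDr mulr_ge0//.
    by rewrite ltW ?Lam_gt0.
  move=> wG; rewrite /W mulr_suml.
  apply: (@le_trans _ _ (\sum_(0 <= k < K) (2 * (weight k * G k)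
      + 16 * (B + s2) * (weight k * \sum_(k <= i < K) lambda i ^+ 2)))).
    by apply: ler_sum_nat => k /andP[_ kK]; exact: step.
  by rewrite big_split/= -!mulr_sumr lerD2r ler_pM2l.
(* This replaces the weighted normalisation by the plain sum, at the price of the factor
   [Lam lambda K] that divides [V K] in [B]. *)
have WS : Lam lambda K * S <= W.
  rewrite mulr_sumr; apply: ler_sum_nat => k /andP[_ kK].
  by rewrite ler_wpM2r ?(ltW (l1l_gt0 _))// Lam_nonincreasing.
have V0 : 0 <= V K.
  by rewrite addr_ge0// mulr_ge0// sumr_ge0// => i _; rewrite mulr_ge0// sqr_ge0.
have VW : V K / W <= S^-1 * B.
  rewrite /B mulrCA ler_wpM2l// -invfM lef_pV2 ?posrE ?mulr_gt0 ?Lam_gt0//.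
  by rewrite mulrC.
rewrite -ler_pdivlMl// QE => /le_trans; apply.
rewrite mulrDr.
have -> : W^-1 * (2 * V K) = 2 * (V K / W) by ring.
have -> : W^-1 * (16 * (B + s2) * N) = 16 * (N / W) * B + 16 * (N / W) * s2 by ring.
lra.
Qed.

End RateFromRecursions.

(** * Stochastic Krasnoselskii-Mann iterates *)

Lemma nonexpansive_borel_measurable (R : realType) (H : completeNormedModType R)
    (H_separable : separable_space H) (S : H -> H) :
  nonexpansive S -> borel_measurable (S : g_sigma_algebraType (@open H) -> H).
Proof.
move=> Sne; apply: borel_measurable_distP => // a.
apply: continuous_borel_measurable; apply: (@lipschitz_continuous _ _ _ 1) => x y.
by rewrite mul1r [leRHS]addrC (le_trans (ler_distD (S y) _ _))// lerD2r.
Qed.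

Section StochasticKMEstimates.
Context (R : realType) (H : completeNormedModType R) (dotp : {dot H for idfun}).
Hypothesis norm_dotp : forall x : H, dotp x x = `|x| ^+ 2.
Hypothesis H_separable : separable_space H.
Let HB := g_sigma_algebraType (@open H).
Context (d : measure_display) (X : measurableType d) (D : probability X R).
Context (T : X -> H -> H) (ET : H -> H).
Hypothesis T_ne : forall t, nonexpansive (T t).
Hypothesis T_meas : forall x, borel_measurable (T ^~ x).
Hypothesis T_int : forall u x, D.-integrable setT (fun t => (dotp u (T t x))%:E).
Hypothesis T_dot :
  forall u x, (\int[D]_t (dotp u (T t x))%:E = (dotp u (ET x))%:E)%E.
Context (lambda : nat -> R) (x0 : H).
Hypothesis lambda01 : forall k, 0 < lambda k < 1.
Context (d' : measure_display) (Omega : measurableType d') (P : probability Omega R).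
Context (xi : nat -> {RV P >-> X}).
Hypothesis xi_law : forall k A, measurable A -> distribution P (xi k) A = D A.
Hypothesis xi_indep : independent xi.
Context (p : H) (s2 : R).
Hypothesis p_fix : ET p = p.
Hypothesis p_var : (\int[D]_t (`|T t p - p| ^+ 2)%:E <= s2%:E)%E.

Let x k w := skm T lambda x0 (fun j => xi j w) k.
Let step k (z : HB * X) : HB := km_step (lambda k) (T z.2) z.1.

Let ET_ne : nonexpansive ET := mean_nonexpansive norm_dotp T_ne T_int T_dot.

Let s2_ge0 : 0 <= s2.
Proof.
by rewrite -lee_fin (le_trans _ p_var)// integral_ge0.
Qed.

Let step_measurable k : measurable_fun setT (step k).
Proof.
apply: (lipschitz_caratheodory_borel H_separable
  (h := fun t y => km_step (lambda k) (T t) y)) => [t|y].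
  exact: km_step_nonexpansive.
exact: (km_step_borel_measurable H_separable _ (T_meas y)).
Qed.

Let x_chain k : x k = driven_chain step x0 xi k.
Proof. by apply/funext => w; elim: k => // k IH; rewrite /x /= -/(x k w) IH. Qed.

Let x_measurable k : measurable_fun setT (x k : Omega -> HB).
Proof. by rewrite x_chain; exact: driven_chain_measurable. Qed.

Let sqr_dist_measurable (a : H) :
  measurable_fun setT ((fun y : H => (`|y - a| ^+ 2)%:E) : HB -> \bar R).
Proof.
by apply/measurable_EFinP/measurable_funX; exact: borel_measurable_norm.
Qed.

Let residual_measurable :
  measurable_fun setT ((fun y : H => (`|ET y - y| ^+ 2)%:E) : HB -> \bar R).
Proof.
apply/measurable_EFinP; apply: measurable_funX.
apply: (continuous_borel_measurable (g := fun y => `|ET y - y|)).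
apply: (@lipschitz_continuous _ _ _ 2) => y z.
have h1 := ET_ne y z.
have h2 := ler_distD (ET z) (ET y) y.
have h3 := ler_distD z (ET z) y.
have h4 : `|z - y| = `|y - z| := distrC z y.
apply: (le_trans h2); rewrite -[leRHS]/(`|ET z - z| + 2 * `|y - z|); lra.
Qed.

Let a k := (\int[P]_w (`|x k w - p| ^+ 2)%:E)%E.
Let r k := (\int[P]_w (`|ET (x k w) - x k w| ^+ 2)%:E)%E.

Let a_ge0 k : (0 <= a k)%E.
Proof. by apply: integral_ge0 => w _; rewrite lee_fin sqr_ge0. Qed.

Let r_ge0 k : (0 <= r k)%E.
Proof. by apply: integral_ge0 => w _; rewrite lee_fin sqr_ge0. Qed.

(** Kept in extended reals, with the residual added on the left: finiteness of [a], by induction,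
    and then of [r] is deduced from it. *)
Let mean_descent k :
  (a k.+1 + (lambda k * (1 - lambda k))%:E * r k <=
   (1 + 2 * lambda k ^+ 2)%:E * a k + (2 * lambda k ^+ 2 * s2)%:E)%E.
Proof.
have /andP[l0 l1] := lambda01 k.
have c0 : 0 <= lambda k * (1 - lambda k) by rewrite ltW// mulr_gt0// subr_gt0.
have l20 : 0 <= 2 * lambda k ^+ 2 by rewrite mulr_ge0// sqr_ge0.
pose F y := (\int[D]_t (`|step k (y, t) - p| ^+ 2)%:E)%E.
have mF : measurable_fun setT (F : HB -> \bar R).
  apply: (measurable_fun_fubini_tonelli_F (m2 := D)
    (fun z : HB * X => (`|step k z - p| ^+ 2)%:E)); last first.
    by move=> z; rewrite lee_fin sqr_ge0.
  exact: (measurableT_comp (sqr_dist_measurable p) (step_measurable k)).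
have -> : a k.+1 = (\int[P]_w F (x k w))%E.
  rewrite /a !x_chain; apply: (ge0_integral_driven_chain_succ (D := D)
    step_measurable x0 xi_law xi_indep k (f := fun y => (`|y - p| ^+ 2)%:E)) => //.
have F0 y : (0 <= F y)%E by apply: integral_ge0 => t _; rewrite lee_fin sqr_ge0.
have mFx : measurable_fun setT (fun w => F (x k w)).
  exact: (measurableT_comp mF (x_measurable k)).
have mrx : measurable_fun setT (fun w => (`|ET (x k w) - x k w| ^+ 2)%:E).
  exact: (measurableT_comp residual_measurable (x_measurable k)).
have max : measurable_fun setT (fun w => (`|x k w - p| ^+ 2)%:E).
  exact: (measurableT_comp (sqr_dist_measurable p) (x_measurable k)).
have b0 : 0 <= 1 + 2 * lambda k ^+ 2 by rewrite addr_ge0.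
have b1 : 0 <= 2 * lambda k ^+ 2 * s2 by rewrite mulr_ge0.
have -> : (2 * lambda k ^+ 2 * s2)%:E =
    (\int[P]_w cst (2 * lambda k ^+ 2 * s2)%:E w)%E.
  by rewrite integral_cst// [X in (_ * X)%E](@probability_setT _ _ _ P) mule1.
rewrite /r /a -!ge0_integralZl_EFin// -!ge0_integralD//; try (exact: measurable_funeM);
  try (by move=> w _; rewrite mule_ge0).
apply: ge0_le_integral => //.
- by move=> w _; rewrite adde_ge0// mule_ge0// lee_fin ?sqr_ge0.
- by apply: emeasurable_funD => //; exact: measurable_funeM.
- by apply: emeasurable_funD => //; exact: measurable_funeM.
move=> w _; rewrite /= -!EFinM -EFinD.
exact: (descent_step norm_dotp H_separable T_ne T_meas T_int T_dot).
Qed.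

Let a_fin k : a k \is a fin_num.
Proof.
elim: k => [|k IH]; rewrite ge0_fin_numE//.
  rewrite /a /x /= integral_cst// [X in (_ * X)%E](@probability_setT _ _ _ P) mule1.
  exact: ltry.
apply: (@le_lt_trans _ _ (a k.+1 + (lambda k * (1 - lambda k))%:E * r k)%E).
  rewrite leeDl// mule_ge0// lee_fin mulr_ge0//.
    by have /andP[/ltW] := lambda01 k.
  by have /andP[_ /ltW] := lambda01 k; rewrite subr_ge0.
by rewrite (le_lt_trans (mean_descent k))// -(fineK IH) -EFinM -EFinD ltry.
Qed.

Let r_fin k : r k \is a fin_num.
Proof.
have /andP[l0 l1] := lambda01 k.
have c0 : 0 < lambda k * (1 - lambda k) by rewrite mulr_gt0 ?subr_gt0.
have h : ((lambda k * (1 - lambda k))%:E * r k < +oo)%E.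
  apply: (@le_lt_trans _ _ (a k.+1 + (lambda k * (1 - lambda k))%:E * r k)%E).
    by rewrite leeDr.
  by rewrite (le_lt_trans (mean_descent k))// -(fineK (a_fin k)) -EFinM -EFinD ltry.
rewrite ge0_fin_numE//; case: (r k) h => [s _||_]; [exact: ltry| |by []].
by rewrite gt0_muley// lte_fin.
Qed.

Lemma measurable_residual_iterate k :
  measurable_fun setT (fun w => (`|ET (x k w) - x k w| ^+ 2)%:E).
Proof. exact: (measurableT_comp residual_measurable (x_measurable k)). Qed.

(** * Coupling with the noiseless iteration *)

Section Coupling.
Context (k0 : nat).

(* The first component of the coupled chain is the stochastic iteration; the
   second one follows it up to time [k0] and is noiseless afterwards. *)
Let pstep i (z : (HB * HB) * X) : HB * HB :=
  (step i (z.1.1, z.2),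
   if (i < k0)%N then step i (z.1.1, z.2) else km_step (lambda i) ET z.1.2).

Let pstep_measurable i : measurable_fun setT (pstep i).
Proof.
have m1 : measurable_fun setT (fun z : (HB * HB) * X => step i (z.1.1, z.2)).
  apply: (measurableT_comp (step_measurable i)).
  apply: measurable_fun_pair; last exact: measurable_snd.
  exact: (measurableT_comp measurable_fst measurable_fst).
apply: measurable_fun_pair => //; case: (i < k0)%N => //.
apply: (measurableT_comp (f := km_step (lambda i) ET : HB -> HB)).
  by apply: nonexpansive_borel_measurable => //; exact: km_step_nonexpansive.
exact: (measurableT_comp measurable_snd measurable_fst).
Qed.

Let y := driven_chain pstep (x0, x0) xi.

Let y1 i w : (y i w).1 = x i w.
Proof. by elim: i => // i; rewrite /y /x /= => ->. Qed.

Let y2 i w : (i <= k0)%N -> (y i w).2 = x i w.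
Proof.
case: i => // i ik; rewrite /y /= ik -/(y i w).
by rewrite /step /= y1.
Qed.

Let dist_measurable :
  measurable_fun setT (fun z : HB * HB => (`|(z.1 : H) - (z.2 : H)| ^+ 2)%:E).
Proof.
apply/measurable_EFinP; apply: measurable_funX.
apply: (lipschitz_caratheodory H_separable (X := HB)
  (phi := fun t u : H => `|u - t|) (L := 1)) => // [t u v|u].
  by rewrite mul1r [leRHS]addrC ler_distD.
apply: continuous_borel_measurable; apply: (@lipschitz_continuous _ _ _ 1) => u' v.
by rewrite mul1r !(distrC u) [leRHS]addrC ler_distD.
Qed.

Let b i := (\int[P]_w (`|((y i w).1 : H) - ((y i w).2 : H)| ^+ 2)%:E)%E.

Let b_succ i : (k0 <= i)%N ->
  (b i.+1 <= b i + (lambda i ^+ 2)%:E * (2%:E * a i + (2 * s2)%:E))%E.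
Proof.
move=> ki.
have l20 : 0 <= lambda i ^+ 2 by exact: sqr_ge0.
pose F z :=
  (\int[D]_t (`|((pstep i (z, t)).1 : H) - ((pstep i (z, t)).2 : H)| ^+ 2)%:E)%E.
have mF : measurable_fun setT F.
  apply: (measurable_fun_fubini_tonelli_F (m2 := D)
    (fun z : (HB * HB) * X =>
      (`|((pstep i z).1 : H) - ((pstep i z).2 : H)| ^+ 2)%:E)) => //.
  exact: (measurableT_comp dist_measurable (pstep_measurable i)).
have -> : b i.+1 = (\int[P]_w F (y i w))%E.
  exact: (ge0_integral_driven_chain_succ (D := D) pstep_measurable (x0, x0)
    xi_law xi_indep i (f := fun z => (`|(z.1 : H) - (z.2 : H)| ^+ 2)%:E)).
have y_measurable : measurable_fun setT (y i) by exact: driven_chain_measurable.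
have mb : measurable_fun setT
    (fun w => (`|((y i w).1 : H) - ((y i w).2 : H)| ^+ 2)%:E).
  exact: (measurableT_comp dist_measurable y_measurable).
have ma : measurable_fun setT (fun w => (`|x i w - p| ^+ 2)%:E).
  exact: (measurableT_comp (sqr_dist_measurable p) (x_measurable i)).
have ms : measurable_fun setT (cst (2 * s2)%:E : Omega -> \bar R) by [].
have s0 : 0 <= 2 * s2 by rewrite mulr_ge0.
have -> : (2 * s2)%:E = (\int[P]_w cst (2 * s2)%:E w)%E.
  by rewrite integral_cst// [X in (_ * X)%E](@probability_setT _ _ _ P) mule1.
have m2a := measurable_funeM 2%:E ma.
have m2as : measurable_fun setT
    (fun w => 2%:E * (`|x i w - p| ^+ 2)%:E + cst (2 * s2)%:E w)%E.
  exact: emeasurable_funD.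
have mlas := measurable_funeM (lambda i ^+ 2)%:E m2as.
have g1 w : (0 <= 2%:E * (`|x i w - p| ^+ 2)%:E)%E by rewrite mule_ge0.
have g2 w : (0 <= 2%:E * (`|x i w - p| ^+ 2)%:E + cst (2 * s2)%:E w)%E.
  by rewrite adde_ge0.
have g3 w : (0 <= (lambda i ^+ 2)%:E *
    (2%:E * (`|x i w - p| ^+ 2)%:E + cst (2 * s2)%:E w))%E by rewrite mule_ge0.
rewrite /a -ge0_integralZl_EFin// -ge0_integralD// -ge0_integralZl_EFin//.
rewrite /b -ge0_integralD//.
apply: ge0_le_integral => //.
- by move=> w _; exact: integral_ge0.
- exact: (measurableT_comp mF y_measurable).
- exact: emeasurable_funD.
move=> w _; rewrite /F /pstep /= ltnNge ki /= -(y1 i w).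
exact: (noise_step norm_dotp H_separable T_ne T_meas T_int T_dot).
Qed.

Let b_le n : (b (k0 + n)%N <=
  (\sum_(k0 <= i < k0 + n) lambda i ^+ 2 * (2 * fine (a i) + 2 * s2))%:E)%E.
Proof.
elim: n => [|n IH].
  (* At time [k0] the two components coincide, so [b] starts from 0. *)
  rewrite addn0 big_geq// /b; under eq_integral do rewrite y1 y2// subrr normr0 expr0n.
  by rewrite integral0.
rewrite addnS big_nat_recr ?leq_addr//= (le_trans (b_succ (leq_addr _ _)))//.
rewrite [X in (_ <= X)%E]EFinD; apply: leeD => //.
by rewrite -[X in (2%:E * X)%E](fineK (a_fin _)).
Qed.

Let residual_le n w :
  `|ET (y (k0 + n)%N w).2 - (y (k0 + n)%N w).2| <= `|ET (x k0 w) - x k0 w|.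
Proof.
elim: n => [|n IH]; first by rewrite addn0 y2.
apply: le_trans IH; rewrite addnS /y /= ltnNge leq_addr /=.
exact: km_step_residual.
Qed.

(** The residual is 2-Lipschitz and does not increase along the noiseless component [v], so at [u]
    it is at most [q + 2 * |u - v|], with [q] the residual at time [k0]. Squaring gives the
    constants 2 and 8. *)
Lemma coupling_drift K : (k0 <= K)%N ->
  fine (r K) <= 2 * fine (r k0) +
    8 * \sum_(k0 <= i < K) lambda i ^+ 2 * (2 * fine (a i) + 2 * s2).
Proof.
move=> kK; have := b_le (K - k0); rewrite subnKC//.
set Sm := \sum_(_ <= i < _) _ => bS.
have y_measurable : measurable_fun setT (y K) by exact: driven_chain_measurable.
have mb : measurable_fun setT
    (fun w => (`|((y K w).1 : H) - ((y K w).2 : H)| ^+ 2)%:E).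
  exact: (measurableT_comp dist_measurable y_measurable).
have mr := measurable_residual_iterate.
have m2r := measurable_funeM 2%:E (mr k0).
have m8b := measurable_funeM 8%:E mb.
have g1 w : (0 <= 2%:E * (`|ET (x k0 w) - x k0 w| ^+ 2)%:E)%E by rewrite mule_ge0.
have g2 w : (0 <= 8%:E * (`|((y K w).1 : H) - ((y K w).2 : H)| ^+ 2)%:E)%E.
  by rewrite mule_ge0.
have : (r K <= 2%:E * r k0 + 8%:E * b K)%E.
  rewrite /r /b -!ge0_integralZl_EFin// -ge0_integralD//.
  apply: ge0_le_integral => //; first exact: emeasurable_funD.
  move=> w _; rewrite -!EFinM -EFinD lee_fin.
  have := residual_le (K - k0) w; rewrite subnKC// -!(y1 K w).
  set u := (y K w).1; set v := (y K w).2; set q := `|ET (x k0 w) - _| => vq.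
  have uv : `|ET u - u| <= q + 2 * `|u - v|.
    have h1 := ET_ne u v.
    have h2 := ler_distD (ET v) (ET u) u.
    have h3 := ler_distD v (ET v) u.
    have h4 : `|v - u| = `|u - v| := distrC v u.
    move: h1 h2 h3 h4 vq; lra.
  have : `|ET u - u| ^+ 2 <= (q + 2 * `|u - v|) ^+ 2.
    have q0 : 0 <= q by exact: normr_ge0.
    by rewrite ler_sqr ?nnegrE// addr_ge0.
  have := sqr_ge0 (q - 2 * `|u - v|).
  move: (`|ET u - u|) (`|u - v|) q {uv vq} => ? ? ?; lra.
move=> rb; rewrite -lee_fin EFinD !EFinM !fineK//.
by rewrite (le_trans rb)// leeD2l// lee_wpmul2l.
Qed.

End Coupling.

Lemma stochastic_km_rate K : (1 <= K)%N ->
  (\int[P]_w (`|ET (x K w) - x K w| ^+ 2)%:E <=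
   ((16 * Q lambda K
       + 2 / (\sum_(0 <= k < K) lambda k * (1 - lambda k)))
      * ((`|x0 - p| ^+ 2 + 2 * \sum_(0 <= k < K) lambda k ^+ 2 * s2)
           / Lam lambda K)
    + 16 * Q lambda K * s2)%:E)%E.
Proof.
move=> K1; rewrite -/(r K) -(fineK (r_fin K)) lee_fin.
have <- : fine (a 0) = `|x0 - p| ^+ 2.
  rewrite /a /x /= integral_cst//.
  by rewrite [X in fine (_ * X)%E](@probability_setT _ _ _ P) mule1.
apply: (@rate_of_recursions _ lambda lambda01 (fine \o a) (fine \o r)) => //.
- by move=> k; rewrite fine_ge0.
- by move=> k; rewrite fine_ge0.
- move=> k; have := mean_descent k.
  rewrite -{1}(fineK (a_fin k.+1)) -{1}(fineK (r_fin k)) -{1}(fineK (a_fin k)).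
  by rewrite -!EFinM -!EFinD lee_fin.
- by move=> k kK; exact: coupling_drift.
Qed.

End StochasticKMEstimates.

(** * Exceptional null sets *)

Section Regularization.
Context (R : realType) (H : completeNormedModType R).
Context (d : measure_display) (X : measurableType d) (N : set X) (T : X -> H -> H).

(* Joint measurability of [(t, x) |-> T t x] needs nonexpansiveness for every [t],
   not only outside the null set [N]. *)
Definition regularize (t : X) (x : H) : H := if t \in N then x else T t x.

Lemma regularize_nonexpansive : (forall t, ~ N t -> nonexpansive (T t)) ->
  forall t, nonexpansive (regularize t).
Proof.
by move=> Tne t x y; rewrite /regularize; case: ifPn => [//|/negP tN];
  apply: Tne => Nt; apply: tN; rewrite inE.
Qed.

Lemma regularize_measurable x : measurable N ->
  borel_measurable (T ^~ x) -> borel_measurable (regularize ^~ x).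
Proof.
move=> mN mT; apply: measurable_fun_ifT => //.
apply: (measurable_fun_bool true); rewrite setTI.
rewrite (_ : _ @^-1` _ = N)//.
by apply/seteqP; split => t /=; [exact: set_mem|exact: mem_set].
Qed.

Lemma regularizeE t x : ~ N t -> regularize t x = T t x.
Proof. by move=> Nt; rewrite /regularize memNset. Qed.

End Regularization.

Section LowerIntegral.
Import HBNNSimple.

(* [f] need not be measurable: its integral is a supremum over the simple
   functions below it, and each of these is almost everywhere below [g]. *)
Lemma ge0_le_integral_negligible (R : realType) (d : measure_display)
    (X : measurableType d) (mu : {measure set X -> \bar R}) (f g : X -> \bar R)
    (N : set X) :
  (forall t, 0 <= f t)%E -> (forall t, 0 <= g t)%E -> measurable_fun setT g ->
  mu.-negligible N -> (forall t, ~ N t -> (f t <= g t)%E) ->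
  (\int[mu]_t f t <= \int[mu]_t g t)%E.
Proof.
move=> f0 g0 mg [M [mM M0 NM]] fg; rewrite ge0_integralTE//.
apply: ge_ereal_sup => _ [h /= hf <-]; rewrite -integralT_nnsfun.
apply: ae_ge0_le_integral => //.
- by move=> t _; rewrite lee_fin; exact: fun_ge0.
- exact/measurable_EFinP/measurable_funP.
exists M; split => // t /= ht; apply: NM; apply: contrapT => Nt; apply: ht => _.
by rewrite (le_trans (hf t))// fg.
Qed.

End LowerIntegral.

(** The infimum runs over distances, not their squares, so for positive [m] the bound is moved to
    [Num.sqrt m] first. *)
Lemma sqr_dist_ge (R : realType) (H : normedModType R) (x : H) (F : set H) (m : R) :
  F !=set0 -> (forall p, F p -> m <= `|x - p| ^+ 2) -> m <= dist x F ^+ 2.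
Proof.
move=> [q Fq] mF; have [m0|m0] := leP m 0.
  by rewrite (le_trans m0)// sqr_ge0.
have sqrt_le : Num.sqrt m <= dist x F.
  apply: lb_le_inf; first by exists `|x - q|, q.
  move=> _ [p Fp <-]; rewrite -[leRHS]ger0_norm// -sqrtr_sqr ler_sqrt ?sqr_ge0//.
  exact: mF.
by rewrite -(sqr_sqrtr (ltW m0)) ler_sqr// nnegrE ?(le_trans _ sqrt_le)// sqrtr_ge0.
Qed.

(** * Convergence rate of the last iterate *)

Theorem mainTheorem4
  (R : realType)
  (* H : real separable Hilbert space *)
  (H : completeNormedModType R)
  (dotp : {dot H for idfun})
  (norm_dotp : forall x : H, dotp x x = `|x| ^+ 2)
  (H_separable : separable_space H)
  (* the distribution D, and the family of operators *)
  (d : measure_display) (X : measurableType d) (D : probability X R)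
  (T : X -> H -> H)
  (T_nonexpansive : {ae D, forall xi, nonexpansive (T xi)})
  (T_measurable : forall x, borel_measurable (fun xi => T xi x))
  (T_integrable : forall x, bochner_integrable D (fun xi => T xi x))
  (ET : H -> H)
  (ET_def : forall x, ET x = bochner_integral D (fun xi => T xi x))
  (Fix_nonempty : fixpoints ET !=set0)
  (sigma : R)
  (bounded_variance : exists2 p0, fixpoints ET p0 &
     ('E_D[fun xi => (`|T xi p0 - ET p0| ^+ 2)%R] <= (sigma ^+ 2)%:E)%E)
  (lambda : nat -> R)
  (lambda01 : forall k, 0 < lambda k < 1)
  (x0 : H)
  (* xi_0, xi_1, ... independent draws from D *)
  (d' : measure_display) (Omega : measurableType d') (P : probability Omega R)
  (xi : nat -> {RV P >-> X})
  (xi_law : forall k A, measurable A -> distribution P (xi k) A = D A)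
  (xi_indep : independent xi)
  (K : nat) (K_ge1 : (1 <= K)%N) :
  let x k omega := skm T lambda x0 (fun j => xi j omega) k in
  ('E_P[fun omega => (`|ET (x K omega) - x K omega| ^+ 2)%R] <=
   ((16 * Q lambda K
       + 2 / (\sum_(0 <= k < K) lambda k * (1 - lambda k)))
      * ((dist x0 (fixpoints ET) ^+ 2
            + 2 * \sum_(0 <= k < K) lambda k ^+ 2 * sigma ^+ 2)
           / Lam lambda K)
    + 16 * Q lambda K * sigma ^+ 2)%:E)%E.
Proof.
pose x k omega := skm T lambda x0 (fun j => xi j omega) k.
rewrite -/x; cbv zeta.
have [N [mN DN NT]] := T_nonexpansive.
have {}NT t : ~ N t -> nonexpansive (T t).
  by move=> Nt; apply: contrapT => Tt; apply: Nt; exact: NT.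
pose T' := regularize N T.
have T'_ne : forall t, nonexpansive (T' t) by exact: regularize_nonexpansive.
have T'_meas z : borel_measurable (T' ^~ z) by exact: regularize_measurable.
have D_aeN (f g : X -> \bar R) : (forall t, ~ N t -> f t = g t) -> ae_eq D setT f g.
  move=> fg; exists N; split => // t /= h; apply: contrapT => Nt.
  by apply: h => _; exact: fg.
have T_dot u z : D.-integrable setT (fun t => (dotp u (T t z))%:E) /\
    (\int[D]_t (dotp u (T t z))%:E = (dotp u (ET z))%:E)%E.
  by rewrite ET_def; exact: bochner_integral_dotp.
have T'_int u z : D.-integrable setT (fun t => (dotp u (T' t z))%:E).
  have mT' : measurable_fun setT (fun t => (dotp u (T' t z))%:E).
    by apply/measurable_EFinP; exact: measurable_dotp.
  apply/integrableP; split => //.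
  have [/integrableP[mT intT] _] := T_dot u z.
  rewrite (ae_eq_integral (fun t => `|(dotp u (T t z))%:E|)%E)//.
  - exact: measurableT_comp.
  - exact: measurableT_comp.
  - by apply: D_aeN => t Nt; rewrite /T' regularizeE.
have T'_dot u z : (\int[D]_t (dotp u (T' t z))%:E = (dotp u (ET z))%:E)%E.
  have [intT <-] := T_dot u z.
  apply: ae_eq_integral => //.
  - exact: measurable_int (T'_int u z).
  - exact: measurable_int intT.
  - by apply: D_aeN => t Nt; rewrite /T' regularizeE.
have [q Eq q_var] := bounded_variance.
have q_var' : (\int[D]_t (`|T' t q - q| ^+ 2)%:E <= (sigma ^+ 2)%:E)%E.
  move: q_var; rewrite unlock; apply: le_trans.
  rewrite (ae_eq_integral (fun t => (`|T t q - ET q| ^+ 2)%:E)%E)//.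
  - by apply/measurable_EFinP/measurable_funX; exact: borel_measurable_norm_comp.
  - by apply/measurable_EFinP/measurable_funX; exact: borel_measurable_norm_comp.
  - by apply: D_aeN => t Nt; rewrite /T' regularizeE// Eq.
(* The regularized iterates differ from [x] only when some draw hits [N], a countable union of null
   events. *)
pose x' k w := skm T' lambda x0 (fun j => xi j w) k.
have xx' k w : ~ (\bigcup_j xi j @^-1` N) w -> x k w = x' k w.
  move=> Nw; elim: k => // k IH.
  rewrite /x /x' /= -/(x k w) -/(x' k w) IH /T' regularizeE// => Nk.
  by apply: Nw; exists k.
set L := 'E_P[_]%E; set bound := (_%:E).
have le_rate p : fixpoints ET p ->
  (L <= ((16 * Q lambda K + 2 / (\sum_(0 <= k < K) lambda k * (1 - lambda k)))
      * ((`|x0 - p| ^+ 2 + 2 * \sum_(0 <= k < K) lambda k ^+ 2 * sigma ^+ 2)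
           / Lam lambda K)
    + 16 * Q lambda K * sigma ^+ 2)%:E)%E.
  move=> Ep.
  have p_var := variance_fix_le norm_dotp T'_ne T'_meas T'_int T'_dot Ep Eq q_var'.
  apply: le_trans (stochastic_km_rate norm_dotp H_separable T'_ne T'_meas T'_int
    T'_dot x0 lambda01 xi_law xi_indep Ep p_var K_ge1).
  rewrite /L unlock.
  (* Joint measurability is known for [T'] only, so the residual of [x] may fail to be measurable; a
     one-sided comparison suffices. *)
  apply: (ge0_le_integral_negligible (N := \bigcup_j xi j @^-1` N)) => //.
  - exact: (measurable_residual_iterate norm_dotp H_separable T'_ne T'_meas T'_int
      T'_dot x0 lambda01 xi K).
  - apply: negligible_bigcup => k; exists (xi k @^-1` N); split => //.
      by rewrite -[_ @^-1` _]setTI; exact: measurable_funP.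
    by rewrite -[LHS]/(distribution P (xi k) N) xi_law.
  - by move=> w Nw; rewrite xx'.
have fin : L \is a fin_num.
  rewrite ge0_fin_numE; first by rewrite (le_lt_trans (le_rate q Eq))// ltry.
  by rewrite /L unlock; exact: integral_ge0.
rewrite /bound -(fineK fin) lee_fin.
have sum_gt0 : 0 < \sum_(0 <= k < K) lambda k * (1 - lambda k).
  rewrite big_ltn// ltr_wpDr//; last first.
    by have /andP[? ?] := lambda01 0; rewrite mulr_gt0// subr_gt0.
  apply: sumr_ge0 => i _; have /andP[? ?] := lambda01 i.
  by rewrite mulr_ge0// ?subr_ge0 ltW.
have Q_ge0 : 0 <= Q lambda K.
  have w0 k : 0 <= Lam lambda k.+1 * (lambda k * (1 - lambda k)).
    have /andP[l0 l1] := lambda01 k.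
    by rewrite mulr_ge0 ?(ltW (Lam_gt0 _ _))// mulr_ge0 ?(ltW l0)// subr_ge0 ltW.
  rewrite divr_ge0// sumr_ge0// => k _; rewrite mulr_ge0// sumr_ge0// => i _.
  by rewrite sqr_ge0.
set c := _ + 2 / _ in le_rate *; set V := 2 * _ in le_rate *.
set e := 16 * _ * _ in le_rate *.
have c0 : 0 < c by apply: ltr_wpDl; [rewrite mulr_ge0|rewrite divr_gt0].
have L0 : 0 < Lam lambda K by exact: Lam_gt0.
(* The bound is affine and increasing in the squared distance. Solving for [y] gives a lower bound
   common to all [|x0 - p|^2], the form that passes to the infimum. *)
have solve_sqr y : (fine L <= c * ((y + V) / Lam lambda K) + e) =
    ((fine L - e) / c * Lam lambda K - V <= y).
  by rewrite -lerBlDr [c * _]mulrC -ler_pdivrMr// ler_pdivlMr// lerBlDr.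
rewrite solve_sqr; apply: sqr_dist_ge => // p Ep.
by rewrite -solve_sqr -lee_fin fineK//; exact: le_rate.
Qed.
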